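(* Let $M$ be an $H_v$-module over an $H_v$-ring $R$ and let $A=(\mu_A,\lambda_A)$ be an intuitionistic fuzzy set in $M$. Then $A$ is an intuitionistic fuzzy $H_v$-submodule of $M$ if and only if both $\Box A=(\mu_A,\mu_A^c)$ and $\Diamond A=(\lambda_A^c,\lambda_A)$ are intuitionistic fuzzy $H_v$-submodules of $M$.
   Context: Hyperoperations. For a non-empty set $H$, $\mathcal P^*(H)$ is the set of non-empty subsets of $H$; a hyperoperation on $H$ is a map $*:H\times H\to\mathcal P^*(H)$. For subsets $A,B\subseteq H$ put $A*B=\bigcup_{a\in A,b\in B}a*b$, and $x*B=\{x\}*B$, $A*x=A*\{x\}$ (likewise for external hyperoperations $R\times M\to\mathcal P^*(M)$). $(H,* )$ is an $H_v$-semigroup if $(x*(y*z))\cap((x*y)*z)\neq\emptyset$ for all $x,y,z\in H$; it is an $H_v$-group if moreover $a*H=H*a=H$ for all $a\in H$. It is weak commutative if $(x*y)\cap(y*x)\ne\emptyset$ for all $x,y$. An $H_v$-ring is a set $R$ with hyperoperations $+,\cdot$ such that $(R,+)$ is an $H_v$-group, $(R,\cdot)$ is an $H_v$-semigroup, and $(x\cdot(y+z))\cap(x\cdot y+x\cdot z)\neq\emptyset$, $((x+y)\cdot z)\cap(x\cdot z+y\cdot z)\ne\emptyset$ for all $x,y,z\in R$. An $H_v$-module over an $H_v$-ring $R$ is a non-empty set $M$ with a hyperoperation $+$ making $(M,+)$ a weak commutative $H_v$-group and a map $\cdot:R\times M\to\mathcal P^*(M)$ such that for all $a,b\in R$, $x,y\in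 M$: $(a\cdot(x+y))\cap(a\cdot x+a\cdot y)\ne\emptyset$, $((a+b)\cdot x)\cap(a\cdot x+b\cdot x)\neq\emptyset$, $((ab)\cdot x)\cap(a\cdot(b\cdot x))\ne\emptyset$. Fuzzy sets. A fuzzy set in $X$ is a map $\mu:X\to[0,1]$; its complement is $\mu^c(x)=1-\mu(x)$. An intuitionistic fuzzy set in $X$ is a pair $A=(\mu_A,\lambda_A)$ of fuzzy sets in $X$ with $0\le\mu_A(x)+\lambda_A(x)\le1$ for all $x\in X$. An intuitionistic fuzzy set $A=(\mu_A,\lambda_A)$ in $M$ is an intuitionistic fuzzy $H_v$-submodule of $M$ if: (1) $\min\{\mu_A(x),\mu_A(y)\}\le\inf\{\mu_A(z)\mid z\in x+y\}$ for all $x,y\in M$; (2) for all $x,a\in M$ there exist $y,z\in M$ with $x\in(a+y)\cap(z+a)$ and $\min\{\mu_A(a),\mu_A(x)\}\le\min\{\mu_A(y),\mu_A(z)\}$; (3) $\mu_A(x)\le\inf\{\mu_A(z)\mid z\in r\cdot x\}$ for all $x\in M$, $r\in R$; (4) $\sup\{\lambda_A(z)\mid z\in x+y\}\le\max\{\lambda_A(x),\lambda_A(y)\}$ for all $x,y\in M$; (5) for all $x,a\in M$ there exist $y,z\in M$ with $x\in(a+y)\cap(z+a)$ and $\max\{\lambda_A(y),\lambda_A(z)\}\le\max\{\lambda_A(a),\lambda_A(x)\}$; (6) $\sup\{\lambda_A(z)\mid z\in r\cdot x\}\le\lambda_A(x)$ for all $x\in M$, $r\in R$. *)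

(* Defs.v *)
From HB Require Import structures.
From mathcomp Require Import all_boot all_order all_algebra.
From mathcomp Require Import classical_sets reals.
From mathcomp Require Import lra.

Set Implicit Arguments.
Unset Strict Implicit.
Unset Printing Implicit Defensive.

Import Order.TTheory GRing.Theory Num.Theory.

Local Open Scope classical_set_scope.
Local Open Scope ring_scope.

Record hyperop (S T U : Type) := Hyperop {
  hop_fun :> S -> T -> set U;
  hop_neq0 : forall s t, hop_fun s t !=set0 }.

Definition hop_set (S T U : Type) (op : hyperop S T U) (A : set S) (B : set T)
  : set U := \bigcup_(a in A) \bigcup_(b in B) op a b.

Definition meets (T : Type) (A B : set T) : Prop := A `&` B !=set0.

Definition Hv_semigroup (H : Type) (op : hyperop H H H) : Prop :=
  forall x y z,
    meets (hop_set op [set x] (op y z)) (hop_set op (op x y) [set z]).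

Definition Hv_group (H : Type) (op : hyperop H H H) : Prop :=
  Hv_semigroup op /\
  forall a, hop_set op [set a] setT = setT /\ hop_set op setT [set a] = setT.

Definition weak_commutative (H : Type) (op : hyperop H H H) : Prop :=
  forall x y, meets (op x y) (op y x).

Record HvRing := MkHvRing {
  hvr_sort :> Type;
  hvr_add : hyperop hvr_sort hvr_sort hvr_sort;
  hvr_mul : hyperop hvr_sort hvr_sort hvr_sort;
  hvr_nonempty : inhabited hvr_sort;
  hvr_addP : Hv_group hvr_add;
  hvr_mulP : Hv_semigroup hvr_mul;
  hvr_distrl : forall x y z,
    meets (hop_set hvr_mul [set x] (hvr_add y z))
          (hop_set hvr_add (hvr_mul x y) (hvr_mul x z));
  hvr_distrr : forall x y z,
    meets (hop_set hvr_mul (hvr_add x y) [set z])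
          (hop_set hvr_add (hvr_mul x z) (hvr_mul y z)) }.

Record HvModule (R : HvRing) := MkHvModule {
  hvm_sort :> Type;
  hvm_add : hyperop hvm_sort hvm_sort hvm_sort;
  hvm_act : hyperop R hvm_sort hvm_sort;
  hvm_nonempty : inhabited hvm_sort;
  hvm_addP : Hv_group hvm_add;
  hvm_addC : weak_commutative hvm_add;
  hvm_actDr : forall (a : R) x y,
    meets (hop_set hvm_act [set a] (hvm_add x y))
          (hop_set hvm_add (hvm_act a x) (hvm_act a y));
  hvm_actDl : forall (a b : R) x,
    meets (hop_set hvm_act (hvr_add R a b) [set x])
          (hop_set hvm_add (hvm_act a x) (hvm_act b x));
  hvm_actA : forall (a b : R) x,
    meets (hop_set hvm_act (hvr_mul R a b) [set x])
          (hop_set hvm_act [set a] (hvm_act b x)) }.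

Record fuzzy_set (K : realType) (X : Type) := FuzzySet {
  fuzzy_fun :> X -> K;
  fuzzy_range : forall x, 0 <= fuzzy_fun x <= 1 }.

Lemma fuzzy_compl_range (K : realType) (X : Type) (mu : fuzzy_set K X) (x : X) :
  0 <= 1 - mu x <= 1.
Proof. by have := fuzzy_range mu x; lra. Qed.

Definition fuzzy_compl (K : realType) (X : Type) (mu : fuzzy_set K X) :
  fuzzy_set K X := FuzzySet (fuzzy_compl_range mu).

Record ifset (K : realType) (X : Type) := IFSet {
  ifs_mu : fuzzy_set K X;
  ifs_lambda : fuzzy_set K X;
  ifs_sum : forall x, 0 <= ifs_mu x + ifs_lambda x <= 1 }.

Lemma ifs_box_sum (K : realType) (X : Type) (mu : fuzzy_set K X) (x : X) :
  0 <= mu x + fuzzy_compl mu x <= 1.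
Proof. by rewrite /=; lra. Qed.

Lemma ifs_diamond_sum (K : realType) (X : Type) (la : fuzzy_set K X) (x : X) :
  0 <= fuzzy_compl la x + la x <= 1.
Proof. by rewrite /=; lra. Qed.

Definition ifs_box (K : realType) (X : Type) (A : ifset K X) : ifset K X :=
  IFSet (ifs_box_sum (ifs_mu A)).

Definition ifs_diamond (K : realType) (X : Type) (A : ifset K X) : ifset K X :=
  IFSet (ifs_diamond_sum (ifs_lambda A)).

(* [inf] and [sup] are only applied to images of the nonempty values of the
   hyperoperations under maps into [0, 1], so their junk values on empty or
   unbounded sets never occur. *)
Record if_Hv_submodule (K : realType) (R : HvRing) (M : HvModule R)
    (A : ifset K M) : Prop := IFHvSubmodule {
  ifsub_mu_add : forall x y : M,
    Num.min (ifs_mu A x) (ifs_mu A y) <= inf (ifs_mu A @` hvm_add M x y);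
  ifsub_mu_sol : forall x a : M, exists y z : M,
    (hvm_add M a y `&` hvm_add M z a) x /\
    Num.min (ifs_mu A a) (ifs_mu A x) <= Num.min (ifs_mu A y) (ifs_mu A z);
  ifsub_mu_act : forall (x : M) (r : R),
    ifs_mu A x <= inf (ifs_mu A @` hvm_act M r x);
  ifsub_lambda_add : forall x y : M,
    sup (ifs_lambda A @` hvm_add M x y)
      <= Num.max (ifs_lambda A x) (ifs_lambda A y);
  ifsub_lambda_sol : forall x a : M, exists y z : M,
    (hvm_add M a y `&` hvm_add M z a) x /\
    Num.max (ifs_lambda A y) (ifs_lambda A z)
      <= Num.max (ifs_lambda A a) (ifs_lambda A x);
  ifsub_lambda_act : forall (x : M) (r : R),
    sup (ifs_lambda A @` hvm_act M r x) <= ifs_lambda A x }.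

(* Main.v *)
(** The conditions on [mu] and those on [lambda] do not interact, and the order
    reversing map [t |-> 1 - t] exchanges min with max and inf with sup.  Hence
    [mu] satisfies (1)-(3) iff its complement satisfies (4)-(6), and conversely;
    [Box A] and [Diamond A] record these two halves of the definition. *)
Require Import Defs.
From HB Require Import structures.
From mathcomp Require Import all_boot all_order all_algebra.
From mathcomp Require Import classical_sets reals.
From mathcomp Require Import lra.

Set Implicit Arguments.
Unset Strict Implicit.
Unset Printing Implicit Defensive.

Import Order.TTheory GRing.Theory Num.Theory.

Local Open Scope classical_set_scope.
Local Open Scope ring_scope.

Lemma max_one_minus (K : realType) (a b : K) :
  Num.max (1 - a) (1 - b) = 1 - Num.min a b.
Proof. by rewrite oppr_min addr_maxr. Qed.

Lemma min_one_minus (K : realType) (a b : K) :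
  Num.min (1 - a) (1 - b) = 1 - Num.max a b.
Proof. by rewrite oppr_max addr_minr. Qed.

(** The bound 0 on fuzzy values makes [inf] a genuine lower bound of the image. Nonemptiness serves
    the converse: over an empty [S] the pointwise condition is vacuous, while [inf] takes its
    default value 0. *)
Lemma le_fuzzy_inf (K : realType) (X : Type) (f : fuzzy_set K X) (S : set X)
    (c : K) : S !=set0 ->
  (c <= inf (f @` S)) <-> (forall z, S z -> c <= f z).
Proof.
move=> [s Ss]; split=> [cf z Sz|cf].
- apply: (le_trans cf); apply: ge_inf; last by exists z.
  by exists 0 => _ [t _ <-]; case/andP: (fuzzy_range f t).
- by apply: lb_le_inf; [exists (f s), s | move=> _ [t St <-]; exact: cf].
Qed.

Lemma fuzzy_sup_le (K : realType) (X : Type) (f : fuzzy_set K X) (S : set X)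
    (c : K) : S !=set0 ->
  (sup (f @` S) <= c) <-> (forall z, S z -> f z <= c).
Proof.
move=> [s Ss]; split=> [fc z Sz|fc].
- apply: le_trans fc; apply: ub_le_sup; last by exists z.
  by exists 1 => _ [t _ <-]; case/andP: (fuzzy_range f t).
- by apply: ge_sup; [exists (f s), s | move=> _ [t St <-]; exact: fc].
Qed.

(** Both sides unfold to pointwise bounds over [S], where [1 - f z <= 1 - c] is just [c <= f z]; no
    formula for the supremum of a complement is required. *)
Lemma fuzzy_compl_sup_le (K : realType) (X : Type) (f : fuzzy_set K X)
    (S : set X) (c : K) : S !=set0 ->
  (sup (fuzzy_compl f @` S) <= 1 - c) <-> (c <= inf (f @` S)).
Proof.
move=> S0; rewrite le_fuzzy_inf // fuzzy_sup_le //=.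
by split=> h z /h; lra.
Qed.

Lemma le_fuzzy_compl_inf (K : realType) (X : Type) (f : fuzzy_set K X)
    (S : set X) (c : K) : S !=set0 ->
  (1 - c <= inf (fuzzy_compl f @` S)) <-> (sup (f @` S) <= c).
Proof.
move=> S0; rewrite le_fuzzy_inf // fuzzy_sup_le //=.
by split=> h z /h; lra.
Qed.

Section Halves.
Variables (K : realType) (R : HvRing) (M : HvModule R).

(** Stated for a single fuzzy set, so that it applies equally to a membership function and to the
    complement of a non-membership function. *)
Definition fuzzy_Hv_submodule (mu : fuzzy_set K M) : Prop :=
  [/\ forall x y : M, Num.min (mu x) (mu y) <= inf (mu @` hvm_add M x y),
      forall x a : M, exists y z : M,
        (hvm_add M a y `&` hvm_add M z a) x /\
        Num.min (mu a) (mu x) <= Num.min (mu y) (mu z) &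
      forall (x : M) (r : R), mu x <= inf (mu @` hvm_act M r x)].

Definition antifuzzy_Hv_submodule (la : fuzzy_set K M) : Prop :=
  [/\ forall x y : M, sup (la @` hvm_add M x y) <= Num.max (la x) (la y),
      forall x a : M, exists y z : M,
        (hvm_add M a y `&` hvm_add M z a) x /\
        Num.max (la y) (la z) <= Num.max (la a) (la x) &
      forall (x : M) (r : R), sup (la @` hvm_act M r x) <= la x].

Lemma if_Hv_submoduleE (A : ifset K M) :
  if_Hv_submodule A <->
  fuzzy_Hv_submodule (ifs_mu A) /\ antifuzzy_Hv_submodule (ifs_lambda A).
Proof. by split=> [[]|[[? ? ?] []]]. Qed.

Lemma antifuzzy_compl (mu : fuzzy_set K M) :
  antifuzzy_Hv_submodule (fuzzy_compl mu) <-> fuzzy_Hv_submodule mu.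
Proof.
split=> -[hadd hsol hact]; split.
- move=> x y; apply/(fuzzy_compl_sup_le _ _ (hop_neq0 _ _ _)).
  by rewrite -max_one_minus; exact: hadd.
(* The same [y] and [z] solve both problems: only the inequality changes, by cancelling [1 -] and
   reversing the order. *)
- move=> x a; have [y [z [xyz]]] := hsol x a.
  by rewrite /= !max_one_minus lerD2l lerN2; exists y, z.
- move=> x r; apply/(fuzzy_compl_sup_le _ _ (hop_neq0 _ _ _)); exact: hact.
- move=> x y; rewrite /= max_one_minus.
  by apply/(fuzzy_compl_sup_le _ _ (hop_neq0 _ _ _)); exact: hadd.
- move=> x a; have [y [z [xyz le_yz]]] := hsol x a.
  by exists y, z; rewrite /= !max_one_minus lerD2l lerN2.
- move=> x r; apply/(fuzzy_compl_sup_le _ _ (hop_neq0 _ _ _)); exact: hact.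
Qed.

(** Proved directly rather than by applying [antifuzzy_compl] to [fuzzy_compl la]: a double
    complement has values [1 - (1 - la x)], which agree with [la] only up to a ring identity. *)
Lemma fuzzy_compl_antifuzzy (la : fuzzy_set K M) :
  fuzzy_Hv_submodule (fuzzy_compl la) <-> antifuzzy_Hv_submodule la.
Proof.
split=> -[hadd hsol hact]; split.
- move=> x y; apply/(le_fuzzy_compl_inf _ _ (hop_neq0 _ _ _)).
  by rewrite -min_one_minus; exact: hadd.
- move=> x a; have [y [z [xyz]]] := hsol x a.
  by rewrite /= !min_one_minus lerD2l lerN2; exists y, z.
- move=> x r; apply/(le_fuzzy_compl_inf _ _ (hop_neq0 _ _ _)); exact: hact.
- move=> x y; rewrite /= min_one_minus.
  by apply/(le_fuzzy_compl_inf _ _ (hop_neq0 _ _ _)); exact: hadd.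
- move=> x a; have [y [z [xyz le_yz]]] := hsol x a.
  by exists y, z; rewrite /= !min_one_minus lerD2l lerN2.
- move=> x r; apply/(le_fuzzy_compl_inf _ _ (hop_neq0 _ _ _)); exact: hact.
Qed.

End Halves.

Theorem theorem4p4 (K : realType) (R : HvRing) (M : HvModule R) (A : ifset K M) :
  if_Hv_submodule A <->
  if_Hv_submodule (ifs_box A) /\ if_Hv_submodule (ifs_diamond A).
Proof.
(* Once complements are removed, the box states the [mu] half twice and the diamond the [lambda]
   half twice, leaving a propositional tautology. *)
rewrite !if_Hv_submoduleE /= antifuzzy_compl fuzzy_compl_antifuzzy.
tauto.
Qed.
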